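(* Let $\ell\ge1$ be an integer, let $\mathcal{D}=\{d^{(2)}_{1,\sigma},d^{(2)}_{2,\sigma}\}_{\sigma\in\operatorname{Perm}(4\ell)}$ be a collection of real constants, and let $(V_1,\varepsilon_1)$ and $(V_2,\varepsilon_2)$ be inner product spaces of signatures $(p_1,q_1)$ and $(p_2,q_2)$ with the same dimension $m=p_1+q_1=p_2+q_2$. Then $$P^{(2)}_{2\ell,\mathcal{D},\varepsilon_1}(A_1)=0\ \ \forall\,A_1\in\mathfrak{A}(V_1)\quad\Longleftrightarrow\quad P^{(2)}_{2\ell,\mathcal{D},\varepsilon_2}(A_2)=0\ \ \forall\,A_2\in\mathfrak{A}(V_2).$$
   Context: An inner product space $(V,\varepsilon)$ of signature $(p,q)$ is a real vector space $V$ of dimension $m=p+q$ with a non-degenerate symmetric bilinear form $\varepsilon$ with $p$ negative and $q$ positive directions. $\mathfrak{A}(V)\subset\otimes^4(V^* )$ is the space of algebraic curvature tensors: those $A$ such that for all $x,y,z,w\in V$, $A(x,y,z,w)=-A(y,x,z,w)=A(z,w,x,y)$ and $A(x,y,z,w)+A(y,z,x,w)+A(z,x,y,w)=0$. $\operatorname{Perm}(4\ell)$ is the group of permutations of $\{1,\dots,4\ell\}$, $\sigma_i=\sigma(i)$; $x\circ y=\frac12(x\otimes y+y\otimes x)$. Let $\{e_i\}$ be a basis of $V$ with dual basis $\{e^i\}$, $\varepsilon^{ij}$ the inverse matrix of $\varepsilon_{ij}=\varepsilon(e_i,e_j)$, and sum over repeated indices. For $A\in\mathfrak{A}(V)$ let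 $\eta=A\otimes\cdots\otimes A$ ($\ell$ factors), with components $\eta_{i_1\dots i_{4\ell}}=A_{i_1i_2i_3i_4}\cdots A_{i_{4\ell-3}i_{4\ell-2}i_{4\ell-1}i_{4\ell}}$, and set $$P^{(2)}_{2\ell,1,\sigma,\varepsilon}(A)=\varepsilon^{i_1i_2}\cdots\varepsilon^{i_{4\ell-3}i_{4\ell-2}}\,\eta_{i_{\sigma_1}\dots i_{\sigma_{4\ell}}}\,e^{i_{4\ell-1}}\circ e^{i_{4\ell}}\in S^2(V^* ),$$ $$P^{(2)}_{2\ell,2,\sigma,\varepsilon}(A)=\varepsilon^{i_1i_2}\cdots\varepsilon^{i_{4\ell-1}i_{4\ell}}\,\eta_{i_{\sigma_1}\dots i_{\sigma_{4\ell}}}\,\varepsilon\in S^2(V^* ),$$ which are independent of the choice of basis, and $$P^{(2)}_{2\ell,\mathcal{D},\varepsilon}=\sum_{\sigma\in\operatorname{Perm}(4\ell)}\left\{d^{(2)}_{1,\sigma}P^{(2)}_{2\ell,1,\sigma,\varepsilon}+d^{(2)}_{2,\sigma}P^{(2)}_{2\ell,2,\sigma,\varepsilon}\right\}.$$ *)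

(* Defs.v *)
From HB Require Import structures.
From mathcomp Require Import all_boot all_order all_algebra.
From mathcomp Require Import perm.
From mathcomp Require Import reals.
From mathcomp Require Import zify.
Set Implicit Arguments.
Unset Strict Implicit.
Unset Printing Implicit Defensive.
Import Order.TTheory GRing.Theory Num.Theory.
Local Open Scope ring_scope.

Section InnerProduct.
Variables (R : realType) (V : vectType R).

Definition has_signature (p q : nat) (eps : {symmetric V}) : Prop :=
  exists2 f : (p + q).-tuple V, basis_of fullv f &
    [/\ forall i j : 'I_(p + q), i != j -> eps f`_i f`_j = 0,
        forall i : 'I_(p + q), (i < p)%N -> eps f`_i f`_i < 0
      & forall i : 'I_(p + q), (p <= i)%N -> 0 < eps f`_i f`_i].

Definition inner_product_space (p q : nat) (eps : {symmetric V}) : Prop :=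
  [/\ \dim {:V} = (p + q)%N, nondegenerate eps & has_signature p q eps].

Definition multilinear4 (A : V -> V -> V -> V -> R) : Prop :=
  [/\ forall y z w, scalar (fun x => A x y z w),
      forall x z w, scalar (fun y => A x y z w),
      forall x y w, scalar (fun z => A x y z w)
    & forall x y z, scalar (fun w => A x y z w)].

Definition alg_curvature (A : V -> V -> V -> V -> R) : Prop :=
  [/\ multilinear4 A,
      forall x y z w, A x y z w = - A y x z w,
      forall x y z w, A x y z w = A z w x y
    & forall x y z w, A x y z w + A y z x w + A z x y w = 0].

End InnerProduct.

(* The positions 1, ..., 4l are encoded by 'I_(4 * l), counting from 0: they are
   cut into l blocks of four (the arguments of the factors A) and into 2l blocks
   of two (the index pairs contracted by the inverse metric). *)
Fact pos4_subproof l (k : 'I_l) (r : 'I_4) : (4 * k + r < 4 * l)%N.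
Proof. by have := ltn_ord k; have := ltn_ord r; lia. Qed.
Definition pos4 l (k : 'I_l) (r : 'I_4) : 'I_(4 * l) :=
  Ordinal (pos4_subproof k r).

Fact pos2_subproof l (k : 'I_(2 * l)) (r : 'I_2) : (2 * k + r < 4 * l)%N.
Proof. by have := ltn_ord k; have := ltn_ord r; lia. Qed.
Definition pos2 l (k : 'I_(2 * l)) (r : 'I_2) : 'I_(4 * l) :=
  Ordinal (pos2_subproof k r).

Fact last_pair_subproof l : (0 < l)%N -> ((2 * l).-1 < 2 * l)%N.
Proof. by lia. Qed.
Definition last_pair l (hl : (0 < l)%N) : 'I_(2 * l) :=
  Ordinal (last_pair_subproof hl).

Section Invariants.
Variables (R : realType) (V : vectType R) (m : nat) (e : m.-tuple V).
Variable eps : {symmetric V}.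

Definition gram : 'M[R]_m := \matrix_(i, j) eps e`_i e`_j.
Definition gram_inv : 'M[R]_m := invmx gram.

Definition sym_prod (a b : V -> R) (x y : V) : R :=
  2^-1 * (a x * b y + b x * a y).

Variables (l : nat) (hl : (0 < l)%N).

Definition eta (A : V -> V -> V -> V -> R) (i : 'I_(4 * l) -> 'I_m) : R :=
  \prod_(k < l) A e`_(i (pos4 k 0)) e`_(i (pos4 k 1))
                  e`_(i (pos4 k 2)) e`_(i (pos4 k 3)).

Definition P1 (s : 'S_(4 * l)) (A : V -> V -> V -> V -> R) (x y : V) : R :=
  \sum_(i : {ffun 'I_(4 * l) -> 'I_m})
    (\prod_(k < 2 * l | k != last_pair hl)
        gram_inv (i (pos2 k 0)) (i (pos2 k 1)))
    * eta A (fun j => i (s j))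
    * sym_prod (coord e (i (pos2 (last_pair hl) 0)))
               (coord e (i (pos2 (last_pair hl) 1))) x y.

Definition P2 (s : 'S_(4 * l)) (A : V -> V -> V -> V -> R) (x y : V) : R :=
  \sum_(i : {ffun 'I_(4 * l) -> 'I_m})
    (\prod_(k < 2 * l) gram_inv (i (pos2 k 0)) (i (pos2 k 1)))
    * eta A (fun j => i (s j)) * eps x y.

Definition PD (d1 d2 : 'S_(4 * l) -> R) (A : V -> V -> V -> V -> R)
    (x y : V) : R :=
  \sum_(s : 'S_(4 * l)) (d1 s * P1 s A x y + d2 s * P2 s A x y).

End Invariants.

(* Main.v *)
Require Import Defs.
From mathcomp Require Import all_boot all_order all_algebra.
From mathcomp Require Import perm.
From mathcomp Require Import reals.
From mathcomp Require Import zify ring.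
Set Implicit Arguments.
Unset Strict Implicit.
Unset Printing Implicit Defensive.
Import Order.TTheory GRing.Theory Num.Theory.
Local Open Scope ring_scope.

(** The only trace of the signature in [PD] is the list of signs of the
    diagonal of the metric in an orthogonal basis, and [PD] depends rationally
    on that diagonal; so a vanishing statement known on one open orthant of
    diagonals propagates to all of them.

    In detail, let [f1] and [f2] be orthogonal bases of the two spaces, with
    inverse norms [u] and [w].  The value of the invariant at a tensor [A] on
    [V2] and at two vectors with coordinates [a] and [b] makes sense for every
    diagonal inverse metric [v] without zero entry; this is [diagonal_PD], and
    at [v = w] it is the value for [eps2].  If [L] sends [f1_i] to [s_i f2_i]
    with [s_i] nonzero, the pullback of [A] along [L] is an algebraic curvature
    tensor on [V1], and its invariant for [eps1] is the value of [diagonal_PD]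
    at [v_i = s_i ^ 2 u_i] ([diagonal_PD_rescale]).  Vanishing on [V1] hence
    gives vanishing at every [v] whose entries have the same signs as those of
    [u].  Along the line [w + t u] the invariant, cleared of denominators by
    [\prod_i v_i], is a polynomial in [t] which vanishes for all large [t],
    hence also at [t = 0], where [v = w] ([diagonal_PD_continuation]).

    The metric being diagonal matters, while [PD] is given in arbitrary bases,
    so its independence of the basis has to be proved first.  Both invariants
    are instances of [contraction], a sum over all multi-indices where each
    pair of slots is weighted by a matrix of its own: the inverse Gram matrix
    for the contracted pairs, the symmetrised product of the coordinates of
    the two arguments for the pair left open.  A change of frame by [M]
    replaces each weight [H] by [M^T H M] ([contraction_frame]), which serves
    both for the independence of the basis and for the rescaling above. *)

(** * Sums over multi-indices cut into blocks *)

(** Distributivity: choosing a multi-index amounts to choosing its restriction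
    to every block, independently. *)
Lemma sum_prod_blocks (R : comPzRingType) (I J K T : finType) (pos : J -> K -> I)
    (F : J -> {ffun K -> T} -> R) :
  bijective (fun jk : J * K => pos jk.1 jk.2) ->
  \sum_(i : {ffun I -> T}) \prod_j F j [ffun k => i (pos j k)]
  = \prod_j \sum_(q : {ffun K -> T}) F j q.
Proof.
case=> inv invK posK; rewrite bigA_distr_bigA /=.
pose blocks (i : {ffun I -> T}) := [ffun j => [ffun k => i (pos j k)]].
rewrite (reindex blocks) /=.
  by apply: eq_bigr => i _; apply: eq_bigr => j _; rewrite ffunE.
exists (fun Q : {ffun J -> {ffun K -> T}} =>
          [ffun p => Q (inv p).1 (inv p).2]) => [i _|Q _].
  by apply/ffunP => p; rewrite !ffunE posK.
by apply/ffunP => j; apply/ffunP => k; rewrite !ffunE (invK (j, k)).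
Qed.

Lemma pos2_bij l : bijective (fun kr : 'I_(2 * l) * 'I_2 => pos2 kr.1 kr.2).
Proof.
apply: inj_card_bij => [[k r] [k' r'] /= /(congr1 val) /= e|].
  have rlt := ltn_ord r; have rlt' := ltn_ord r'.
  by congr (_, _); apply: val_inj => /=; lia.
by rewrite card_prod !card_ord; lia.
Qed.

Lemma pos4_bij l : bijective (fun kr : 'I_l * 'I_4 => pos4 kr.1 kr.2).
Proof.
apply: inj_card_bij => [[k r] [k' r'] /= /(congr1 val) /= e|].
  have rlt := ltn_ord r; have rlt' := ltn_ord r'.
  by congr (_, _); apply: val_inj => /=; lia.
by rewrite card_prod !card_ord; lia.
Qed.

Lemma prod_blocks (R : comPzRingType) (I J K : finType) (pos : J -> K -> I)
    (F : I -> R) :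
  bijective (fun jk : J * K => pos jk.1 jk.2) ->
  \prod_p F p = \prod_j \prod_k F (pos j k).
Proof.
move=> pos_bij; rewrite pair_bigA /=.
by rewrite (reindex (fun jk : J * K => pos jk.1 jk.2)) //; apply: onW_bij.
Qed.

Lemma sum_ffun2 (R : nmodType) (T : finType) (F : T -> T -> R) :
  \sum_(q : {ffun 'I_2 -> T}) F (q 0) (q 1) = \sum_a \sum_b F a b.
Proof.
rewrite pair_bigA /= (reindex (fun c : T * T =>
  [ffun r : 'I_2 => nth c.1 [:: c.1; c.2] r])) /=.
  by apply: eq_bigr => -[a b] _; rewrite !ffunE.
exists (fun q : {ffun 'I_2 -> T} => (q 0, q 1)) => [[a b] _|q _].
  by rewrite !ffunE.
apply/ffunP => -[[|[|//]] r]; rewrite ffunE /=; congr (q _); exact: val_inj.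
Qed.

Lemma sum_ffun4 (R : nmodType) (T : finType) (F : T -> T -> T -> T -> R) :
  \sum_(q : {ffun 'I_4 -> T}) F (q 0) (q 1) (q 2) (q 3)
  = \sum_a \sum_b \sum_c \sum_d F a b c d.
Proof.
rewrite pair_bigA pair_bigA pair_bigA /= (reindex (fun c : T * T * T * T =>
  [ffun r : 'I_4 => nth c.2 [:: c.1.1.1; c.1.1.2; c.1.2; c.2] r])) /=.
  by apply: eq_bigr => -[[[a b] c] d] _; rewrite !ffunE.
exists (fun q : {ffun 'I_4 -> T} => (q 0, q 1, q 2, q 3)) => [[[[a b] c] d] _|q _].
  by rewrite !ffunE.
apply/ffunP => -[[|[|[|[|//]]]] r]; rewrite ffunE /=; congr (q _); exact: val_inj.
Qed.

(** * Contractions and change of frame *)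

Section Contraction.
Variables (R : realType) (m l : nat).
Implicit Types (V : vectType R) (s : 'S_(4 * l)) (H : 'I_(2 * l) -> 'M[R]_m).

Lemma scalar_sum V (f : V -> R) (w : 'I_m -> V) (c : 'I_m -> R) :
  scalar f -> f (\sum_j c j *: w j) = \sum_j c j * f (w j).
Proof.
move=> flin.
have f0 : f 0 = 0.
  by have := flin (-1) 0 0; rewrite scaler0 addr0 mulN1r addNr.
elim/big_rec2: _ => [//|j y x _ <-]; exact: flin.
Qed.

Definition eta_of V (v : 'I_m -> V) (A : V -> V -> V -> V -> R)
    (i : 'I_(4 * l) -> 'I_m) : R :=
  \prod_(k < l) A (v (i (pos4 k 0))) (v (i (pos4 k 1)))
                  (v (i (pos4 k 2))) (v (i (pos4 k 3))).

(** Weighting each pair of slots by a separate matrix lets one formula cover the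
    complete contractions and those which leave a pair open. *)
Definition contraction V (v : 'I_m -> V) H s A : R :=
  \sum_(i : {ffun 'I_(4 * l) -> 'I_m})
    (\prod_(k < 2 * l) H k (i (pos2 k 0)) (i (pos2 k 1)))
    * eta_of v A (fun p => i (s p)).

Lemma multilinear4_frame V A (v w : 'I_m -> V) (M : 'M_m) (i : 'I_4 -> 'I_m) :
  multilinear4 A -> (forall a, v a = \sum_b M a b *: w b) ->
  A (v (i 0)) (v (i 1)) (v (i 2)) (v (i 3)) =
  \sum_(q : {ffun 'I_4 -> 'I_m})
    (\prod_r M (i r) (q r)) * A (w (q 0)) (w (q 1)) (w (q 2)) (w (q 3)).
Proof.
case=> A1 A2 A3 A4 vE; pose mon a b c d := M (i 0) a * M (i 1) b * M (i 2) c * M (i 3) d.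
transitivity (\sum_(q : {ffun 'I_4 -> 'I_m})
   mon (q 0) (q 1) (q 2) (q 3) * A (w (q 0)) (w (q 1)) (w (q 2)) (w (q 3))).
  rewrite (sum_ffun4 (fun a b c d => mon a b c d * A (w a) (w b) (w c) (w d))).
  rewrite 4!vE (scalar_sum _ _ (A1 _ _ _)); apply: eq_bigr => a _.
  rewrite (scalar_sum _ _ (A2 _ _ _)) mulr_sumr; apply: eq_bigr => b _.
  rewrite (scalar_sum _ _ (A3 _ _ _)) 2!mulr_sumr; apply: eq_bigr => c _.
  rewrite (scalar_sum _ _ (A4 _ _ _)) 3!mulr_sumr; apply: eq_bigr => d _.
  by rewrite /mon; ring.
apply: eq_bigr => q _; congr (_ * _).
rewrite /mon !big_ord_recr big_ord0 /= mul1r.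
by congr (M (i _) (q _) * M (i _) (q _) * M (i _) (q _) * M (i _) (q _));
  apply: val_inj.
Qed.

Lemma eta_of_frame V A (v w : 'I_m -> V) (M : 'M_m) (i : 'I_(4 * l) -> 'I_m) :
  multilinear4 A -> (forall a, v a = \sum_b M a b *: w b) ->
  eta_of v A i =
  \sum_(j : {ffun 'I_(4 * l) -> 'I_m})
    (\prod_p M (i p) (j p)) * eta_of w A j.
Proof.
move=> Alin vE; rewrite /eta_of.
pose F (k : 'I_l) (q : {ffun 'I_4 -> 'I_m}) :=
  (\prod_r M (i (pos4 k r)) (q r)) * A (w (q 0)) (w (q 1)) (w (q 2)) (w (q 3)).
transitivity (\prod_k \sum_q F k q).
  apply: eq_bigr => k _.
  exact: (multilinear4_frame (fun r => i (pos4 k r)) Alin vE).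
rewrite -(sum_prod_blocks _ (pos4_bij l)); apply: eq_bigr => j _.
rewrite (prod_blocks _ (pos4_bij l)) -big_split /=; apply: eq_bigr => k _.
by rewrite /F !ffunE; congr (_ * _); apply: eq_bigr => r _; rewrite ffunE.
Qed.

(** Expand [eta] in the frame [w], rename the new indices by [s] so that the
    entries of [M] no longer involve the permutation, and sum over the old
    indices first: that sum factors over the pairs of slots, each factor being
    an entry of [M^T H M]. *)
Lemma contraction_frame V A (v w : 'I_m -> V) (M : 'M_m) H s :
  multilinear4 A -> (forall a, v a = \sum_b M a b *: w b) ->
  contraction v H s A = contraction w (fun k => M^T *m H k *m M) s A.
Proof.
move=> Alin vE; rewrite /contraction.
pose term (i j : {ffun 'I_(4 * l) -> 'I_m}) :=
  (\prod_(k < 2 * l) H k (i (pos2 k 0)) (i (pos2 k 1)))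
  * \prod_p M (i p) (j p) * eta_of w A (fun p => j (s p)).
transitivity (\sum_i \sum_j term i j).
  apply: eq_bigr => i _; rewrite (eta_of_frame _ Alin vE) mulr_sumr.
  (* The index attached to the slot [s p] of [i] is called [j (s p)]. *)
  rewrite (reindex (fun j : {ffun 'I_(4 * l) -> 'I_m} => [ffun p => j (s p)])) /=.
    apply: eq_bigr => j _; rewrite /term mulrA; congr (_ * _ * _).
      rewrite [RHS](reindex_inj (@perm_inj _ s)) /=.
      by apply: eq_bigr => p _; rewrite ffunE.
    by apply: eq_bigr => k _; rewrite !ffunE.
  exists (fun j : {ffun 'I_(4 * l) -> 'I_m} => [ffun p => j (s^-1%g p)]) => j _.
    by apply/ffunP => p; rewrite !ffunE permKV.
  by apply/ffunP => p; rewrite !ffunE permK.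
rewrite exchange_big /=; apply: eq_bigr => j _; rewrite -mulr_suml; congr (_ * _).
pose F (k : 'I_(2 * l)) (q : {ffun 'I_2 -> 'I_m}) :=
  H k (q 0) (q 1) * \prod_r M (q r) (j (pos2 k r)).
transitivity (\sum_(i : {ffun 'I_(4 * l) -> 'I_m})
                \prod_k F k [ffun r => i (pos2 k r)]).
  apply: eq_bigr => i _; rewrite (prod_blocks _ (pos2_bij l)) -big_split /=.
  apply: eq_bigr => k _; rewrite /F !ffunE; congr (_ * _).
  by apply: eq_bigr => r _; rewrite ffunE.
rewrite (sum_prod_blocks _ (pos2_bij l)); apply: eq_bigr => k _.
pose G a b := H k a b * (M a (j (pos2 k 0)) * M b (j (pos2 k 1))).
transitivity (\sum_(q : {ffun 'I_2 -> 'I_m}) G (q 0) (q 1)).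
  apply: eq_bigr => q _; rewrite /F /G !big_ord_recr big_ord0 /= mul1r.
  by congr (_ * (M (q _) (j (pos2 k _)) * M (q _) (j (pos2 k _)))); apply: val_inj.
rewrite (sum_ffun2 G) mxE exchange_big /=; apply: eq_bigr => b _.
rewrite mxE mulr_suml; apply: eq_bigr => a _; rewrite /G mxE; ring.
Qed.

End Contraction.

(** * Independence of the basis *)

Section Frames.
Variables (R : realType) (m l : nat) (hl : (0 < l)%N) (d1 d2 : 'S_(4 * l) -> R).
Implicit Types (V : vectType R) (B S M : 'M[R]_m).

(** The invariant with its ingredients decoupled: a frame, an inverse metric
    [B], the weight [S] of the open pair, and the value [c] of the metric on
    the two arguments, none of them assumed to come from the others. *)
Definition frame_PD V (v : 'I_m -> V) B S (c : R) A : R :=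
  \sum_(s : 'S_(4 * l))
    (d1 s * contraction v (fun k => if k == last_pair hl then S else B) s A
     + d2 s * (contraction v (fun=> B) s A * c)).

Definition sym_outer (a b : 'rV[R]_m) : 'M[R]_m := 2^-1 *: (a^T *m b + b^T *m a).

Definition coords V (e : m.-tuple V) (x : V) : 'rV[R]_m := \row_i coord e i x.

Lemma frame_PD_change V A (v w : 'I_m -> V) B S M c :
  multilinear4 A -> (forall a, v a = \sum_b M a b *: w b) ->
  frame_PD v B S c A = frame_PD w (M^T *m B *m M) (M^T *m S *m M) c A.
Proof.
move=> Alin vE; apply: eq_bigr => s _; rewrite !(contraction_frame _ _ Alin vE).
congr (_ * _ + _); apply: eq_bigr => i _; congr (_ * _).
by apply: eq_bigr => k _; case: ifP.
Qed.

Lemma sym_outer_change a b M :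
  M^T *m sym_outer a b *m M = sym_outer (a *m M) (b *m M).
Proof.
by rewrite /sym_outer -scalemxAr -scalemxAl !trmx_mul mulmxDr mulmxDl !mulmxA.
Qed.

Lemma PD_frameE V (e : m.-tuple V) (eps : {symmetric V}) A x y :
  PD e eps hl d1 d2 A x y =
  frame_PD (fun i => e`_i) (gram_inv e eps) (sym_outer (coords e x) (coords e y))
    (eps x y) A.
Proof.
apply: eq_bigr => s _; congr (_ * _ + _ * _); last by rewrite /P2 -mulr_suml.
apply: eq_bigr => i _; rewrite mulrAC [in RHS](bigD1 (last_pair hl)) //= eqxx.
congr (_ * _); rewrite mulrC; congr (_ * _).
  by rewrite !mxE !big_ord1 !mxE /sym_prod; ring.
by apply: eq_bigr => k /negbTE ->.
Qed.

Definition transition V (e f : m.-tuple V) : 'M[R]_m :=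
  \matrix_(i, j) coord f j e`_i.

Section Bases.
Variables (V : vectType R) (e f : m.-tuple V).
Hypotheses (he : basis_of fullv e) (hf : basis_of fullv f).

Lemma basis_expand x : x = \sum_i coords f x 0 i *: f`_i.
Proof.
rewrite {1}(coord_basis hf (memvf x)).
by apply: eq_bigr => i _; rewrite mxE.
Qed.

Lemma transitionE (i : 'I_m) : e`_i = \sum_j transition e f i j *: f`_j.
Proof.
by rewrite [LHS]basis_expand; apply: eq_bigr => j _; rewrite !mxE.
Qed.

Lemma coords_transition x : coords e x *m transition e f = coords f x.
Proof.
apply/rowP => j; rewrite !mxE {2}(coord_basis he (memvf x)) linear_sum /=.
by apply: eq_bigr => i _; rewrite linearZ !mxE.
Qed.

Lemma form_expand (eps : {symmetric V}) x y :
  eps x y = \sum_i \sum_j coords f x 0 i * coords f y 0 j * eps f`_i f`_j.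
Proof.
rewrite {1}(basis_expand x) {1}(basis_expand y) linear_sumlz.
apply: eq_bigr => i _; rewrite linear_sumr.
by apply: eq_bigr => j _; rewrite linearZr_LR linearZl_LR /= mulrCA mulrA.
Qed.

Lemma gram_transition (eps : {symmetric V}) :
  gram e eps = transition e f *m gram f eps *m (transition e f)^T.
Proof.
apply/matrixP => i j; rewrite !mxE form_expand exchange_big /=.
apply: eq_bigr => k _; rewrite [in RHS]mxE mulr_suml.
by apply: eq_bigr => h _; rewrite !mxE mulrAC.
Qed.

End Bases.

(** The transition matrices of [e] to [f] and of [f] to [e] are inverse to each
    other, as both express changes of coordinates. *)
Lemma transition_unit V (e f : m.-tuple V) :
  basis_of fullv e -> basis_of fullv f -> transition e f \in unitmx.
Proof.
move=> he hf.
suff /mulmx1_unit[]: transition e f *m transition f e = 1%:M by [].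
apply/row_matrixP => i; rewrite row_mul row1.
have -> : row i (transition e f) = coords f e`_i by apply/rowP => j; rewrite !mxE.
rewrite coords_transition //; apply/rowP => j.
by rewrite !mxE (coord_free _ _ (basis_free he)) eqxx eq_sym.
Qed.

Lemma gram_inv_transition V (e f : m.-tuple V) (eps : {symmetric V}) :
  basis_of fullv e -> basis_of fullv f -> gram f eps \in unitmx ->
  (transition e f)^T *m gram_inv e eps *m transition e f = gram_inv f eps.
Proof.
move=> he hf g_unit; have M_unit := transition_unit he hf.
have Mt_unit : (transition e f)^T \in unitmx by rewrite unitmx_tr.
have geE := gram_transition e hf eps.
have ge_unit : gram e eps \in unitmx by rewrite geE !unitmx_mul M_unit g_unit.
rewrite -[LHS](mulmxK g_unit) /gram_inv -[RHS]mul1mx; congr (_ *m _).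
apply: (can_inj (mulmxK Mt_unit)).
by rewrite mul1mx -!mulmxA (mulmxA (transition e f)) -geE mulVmx ?mulmx1.
Qed.

Lemma PD_basis_change V (e f : m.-tuple V) (eps : {symmetric V}) A x y :
  basis_of fullv e -> basis_of fullv f -> gram f eps \in unitmx ->
  multilinear4 A ->
  PD e eps hl d1 d2 A x y = PD f eps hl d1 d2 A x y.
Proof.
move=> he hf g_unit Alin.
rewrite !PD_frameE (frame_PD_change _ _ _ Alin (transitionE e hf)).
by rewrite sym_outer_change !coords_transition // gram_inv_transition.
Qed.

End Frames.

(** * Polynomial functions of one variable *)

Section PolynomialFunctions.
Variable R : realType.

Definition polynomial_fun (F : R -> R) := exists p : {poly R}, forall t, F t = p.[t].

Lemma polynomial_fun_cst c : polynomial_fun (fun=> c).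
Proof. by exists c%:P => t; rewrite hornerC. Qed.

Lemma polynomial_fun_affine b c : polynomial_fun (fun t => b + t * c).
Proof. by exists (b%:P + 'X * c%:P) => t; rewrite !hornerE. Qed.

Lemma polynomial_funD F G :
  polynomial_fun F -> polynomial_fun G -> polynomial_fun (fun t => F t + G t).
Proof. by move=> [p Fp] [q Gq]; exists (p + q) => t; rewrite hornerD Fp Gq. Qed.

Lemma polynomial_funM F G :
  polynomial_fun F -> polynomial_fun G -> polynomial_fun (fun t => F t * G t).
Proof. by move=> [p Fp] [q Gq]; exists (p * q) => t; rewrite hornerM Fp Gq. Qed.

Lemma polynomial_fun_sum (I : finType) (P : pred I) (F : I -> R -> R) :
  (forall i, P i -> polynomial_fun (F i)) ->
  polynomial_fun (fun t => \sum_(i | P i) F i t).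
Proof.
move=> Fpoly; suff h r : polynomial_fun (fun t => \sum_(i <- r | P i) F i t) by [].
elim: r => [|i r [q IH]].
  by exists 0 => t; rewrite big_nil horner0.
have [Pi|nPi] := boolP (P i); last by exists q => t; rewrite big_cons (negbTE nPi).
have [p Fp] := Fpoly i Pi.
by exists (p + q) => t; rewrite big_cons Pi hornerD IH Fp.
Qed.

Lemma polynomial_fun_prod (I : finType) (P : pred I) (F : I -> R -> R) :
  (forall i, P i -> polynomial_fun (F i)) ->
  polynomial_fun (fun t => \prod_(i | P i) F i t).
Proof.
move=> Fpoly; suff h r : polynomial_fun (fun t => \prod_(i <- r | P i) F i t) by [].
elim: r => [|i r [q IH]].
  by exists 1 => t; rewrite big_nil hornerC.
have [Pi|nPi] := boolP (P i); last by exists q => t; rewrite big_cons (negbTE nPi).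
have [p Fp] := Fpoly i Pi.
by exists (p * q) => t; rewrite big_cons Pi hornerM IH Fp.
Qed.

Lemma polynomial_fun_eq0 F T :
  polynomial_fun F -> (forall t, T < t -> F t = 0) -> forall t, F t = 0.
Proof.
move=> [p Fp] F0 t; suff -> : F t = (0 : {poly R}).[t] by rewrite horner0.
rewrite Fp; congr (_.[t]).
apply: (@roots_geq_poly_eq0 _ _ [seq T + n.+1%:R | n <- iota 0 (size p)]).
- by apply/allP => _ /mapP[n _ ->]; rewrite /root -Fp F0 // ltrDl ltr0Sn.
- rewrite map_inj_uniq ?iota_uniq // => n k /addrI/eqP.
  by rewrite eqr_nat => /eqP[].
- by rewrite size_map size_iota.
Qed.

End PolynomialFunctions.

Lemma polynomial_fun_contraction (R : realType) m l (V : vectType R)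
    (v : 'I_m -> V) (H : R -> 'I_(2 * l) -> 'M[R]_m) (s : 'S_(4 * l)) A :
  (forall k i j, polynomial_fun (fun t => H t k i j)) ->
  polynomial_fun (fun t => contraction v (H t) s A).
Proof.
move=> Hpoly; apply: polynomial_fun_sum => i _.
apply: polynomial_funM; last exact: polynomial_fun_cst.
by apply: polynomial_fun_prod => k _.
Qed.

(** * Orthogonal bases and pullbacks *)

Lemma alg_curvature_pullback (R : realType) (V W : vectType R) (L : V -> W) A :
  linear L -> alg_curvature A ->
  alg_curvature (fun x y z w => A (L x) (L y) (L z) (L w)).
Proof.
move=> Llin [[A1 A2 A3 A4] Aanti Apair Abianchi]; split=> //.
split.
- by move=> y z w c a b; rewrite Llin A1.
- by move=> x z w c a b; rewrite Llin A2.
- by move=> x y w c a b; rewrite Llin A3.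
- by move=> x y z c a b; rewrite Llin A4.
Qed.

Section Orthogonal.
Variables (R : realType) (V : vectType R).

Definition orthogonal_basis m (eps : {symmetric V}) (f : m.-tuple V) :=
  [/\ basis_of fullv f,
      forall i j : 'I_m, i != j -> eps f`_i f`_j = 0
    & forall i : 'I_m, eps f`_i f`_i != 0].

(** All that is kept of the signature is that no norm is zero. *)
Lemma inner_product_space_orthogonal_basis m p q (eps : {symmetric V}) :
  m = (p + q)%N -> inner_product_space p q eps ->
  exists f : m.-tuple V, orthogonal_basis eps f.
Proof.
move=> -> [_ _ [f fb [f_orth f_neg f_pos]]]; exists f; split=> // i.
by have [/f_neg /ltr0_neq0|/f_pos /lt0r_neq0] := ltnP i p.
Qed.

Definition inv_norms m (eps : {symmetric V}) (f : m.-tuple V) : 'rV[R]_m :=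
  \row_i (eps f`_i f`_i)^-1.

Variables (m : nat) (eps : {symmetric V}) (f : m.-tuple V).
Hypothesis hf : orthogonal_basis eps f.

Lemma orthogonal_gramK : gram f eps *m diag_mx (inv_norms eps f) = 1%:M.
Proof.
case: hf => _ f_orth f_neq0.
apply/matrixP => i j; rewrite mul_mx_diag !mxE.
have [<-|ij] := eqVneq i j; first by rewrite mulfV.
by rewrite f_orth // mul0r.
Qed.

Lemma orthogonal_gram_unit : gram f eps \in unitmx.
Proof. by have [] := mulmx1_unit orthogonal_gramK. Qed.

Lemma orthogonal_gram_inv : gram_inv f eps = diag_mx (inv_norms eps f).
Proof.
rewrite /gram_inv -[LHS]mulmx1 -orthogonal_gramK mulmxA.
by rewrite mulVmx ?orthogonal_gram_unit // mul1mx.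
Qed.

Lemma orthogonal_form x y :
  eps x y = \sum_i coords f x 0 i * coords f y 0 i / inv_norms eps f 0 i.
Proof.
case: hf => fb f_orth _; rewrite (form_expand fb).
apply: eq_bigr => i _; rewrite (bigD1 i) //= big1 ?addr0 => [|j ji].
  by rewrite !mxE invrK.
by rewrite f_orth ?mulr0 // eq_sym.
Qed.

End Orthogonal.

(** * Passing from one signature to another *)

Section Transfer.
Variables (R : realType) (m l : nat) (hl : (0 < l)%N) (d1 d2 : 'S_(4 * l) -> R).

(** The invariant at the metric for which [f] is orthogonal with inverse norms
    [v], evaluated at the vectors with coordinates [a] and [b]; [v] is a free
    parameter, independent of any form on [V]. *)
Definition diagonal_PD (V : vectType R) (f : m.-tuple V) A (a b v : 'rV[R]_m) : R :=
  frame_PD hl d1 d2 (fun i => f`_i) (diag_mx v) (sym_outer a b)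
    (\sum_i a 0 i * b 0 i / v 0 i) A.

Lemma PD_orthogonal (V : vectType R) (e f : m.-tuple V) (eps : {symmetric V}) A x y :
  basis_of fullv e -> orthogonal_basis eps f -> multilinear4 A ->
  PD e eps hl d1 d2 A x y =
  diagonal_PD f A (coords f x) (coords f y) (inv_norms eps f).
Proof.
move=> he hf Alin; have [fb _ _] := hf.
rewrite (PD_basis_change _ _ _ _ _ he fb (orthogonal_gram_unit hf) Alin).
by rewrite PD_frameE (orthogonal_gram_inv hf) (orthogonal_form hf).
Qed.

(** The arguments are divided by the scaling factors so that [L] maps them to
    vectors with the fixed coordinates [a] and [b]: only the metric moves. *)
Lemma diagonal_PD_rescale (V W : vectType R) (f : m.-tuple V) (h : m.-tuple W)
    (L : V -> W) A (a b u sc : 'rV[R]_m) :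
  multilinear4 A -> (forall i : 'I_m, L f`_i = sc 0 i *: h`_i) ->
  (forall i, sc 0 i != 0) ->
  diagonal_PD f (fun x y z w => A (L x) (L y) (L z) (L w))
    (\row_i (a 0 i / sc 0 i)) (\row_i (b 0 i / sc 0 i)) u =
  diagonal_PD h A a b (\row_i (sc 0 i ^+ 2 * u 0 i)).
Proof.
move=> Alin LE sc0; rewrite /diagonal_PD.
set c := \sum_i _; set c' := \sum_i _; have -> : c = c'.
  apply: eq_bigr => i _; rewrite !mxE invfM expr2 invfM; ring.
rewrite -[LHS]/(frame_PD hl d1 d2 (fun i : 'I_m => L f`_i) _ _ _ A).
have LE' (i : 'I_m) : L f`_i = \sum_j diag_mx sc i j *: h`_j.
  rewrite LE (bigD1 i) //= big1 ?addr0 ?mxE ?eqxx // => j /negbTE ji.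
  by rewrite mxE eq_sym ji scale0r.
rewrite (frame_PD_change hl d1 d2 _ _ _ Alin LE') sym_outer_change.
rewrite tr_diag_mx !mulmx_diag !mul_mx_diag.
congr (frame_PD _ _ _ _ (diag_mx _) (sym_outer _ _) _ _).
- by apply/rowP => i; rewrite !mxE; ring.
- by apply/rowP => i; rewrite !mxE divfK.
- by apply/rowP => i; rewrite !mxE divfK.
Qed.

(** The ray [w + t u] enters the orthant of [u] as [t] grows, and the invariant
    is a rational function of [t]. *)
Lemma diagonal_PD_continuation (V : vectType R) (f : m.-tuple V) A
    (a b u w : 'rV[R]_m) :
  (forall i, u 0 i != 0) -> (forall i, w 0 i != 0) ->
  (forall v : 'rV[R]_m, (forall i, 0 < v 0 i / u 0 i) -> diagonal_PD f A a b v = 0) ->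
  diagonal_PD f A a b w = 0.
Proof.
move=> u0 w0 vanish; pose v (t : R) : 'rV[R]_m := w + t *: u.
pose open_part t := \sum_(s : 'S_(4 * l)) d1 s * contraction (fun i : 'I_m => f`_i)
  (fun k => if k == last_pair hl then sym_outer a b else diag_mx (v t)) s A.
pose closed_part t := \sum_(s : 'S_(4 * l)) d2 s *
  contraction (fun i : 'I_m => f`_i) (fun=> diag_mx (v t)) s A.
have splitE t : diagonal_PD f A a b (v t) =
    open_part t + closed_part t * \sum_i a 0 i * b 0 i / v t 0 i.
  rewrite /diagonal_PD /frame_PD big_split /=; congr (_ + _).
  by rewrite mulr_suml; apply: eq_bigr => s _; rewrite mulrA.
(* [diagonal_PD] multiplied by the product of the inverse norms, which absorbs
   the division by each of them in the value of the metric. *)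
pose F t := (\prod_i v t 0 i) * open_part t +
  closed_part t * \sum_i a 0 i * b 0 i * \prod_(j | j != i) v t 0 j.
have FE t : (forall i, v t 0 i != 0) ->
    F t = (\prod_i v t 0 i) * diagonal_PD f A a b (v t).
  move=> vt0; rewrite splitE mulrDr; congr (_ + _).
  rewrite mulrCA; congr (_ * _); rewrite mulr_sumr.
  apply: eq_bigr => i _; rewrite [in RHS](bigD1 i) //=.
  by field; exact: vt0.
have v_poly i : polynomial_fun (fun t => v t 0 i).
  have [p pE] := polynomial_fun_affine (w 0 i) (u 0 i).
  by exists p => t; rewrite !mxE pE.
have diag_poly i j : polynomial_fun (fun t => diag_mx (v t) i j).
  have [->|ij] := eqVneq i j.
    by have [p pE] := v_poly j; exists p => t; rewrite mxE eqxx pE.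
  by exists 0 => t; rewrite mxE (negbTE ij) horner0.
have F_poly : polynomial_fun F.
  apply: polynomial_funD.
    apply: polynomial_funM; first by apply: polynomial_fun_prod.
    apply: polynomial_fun_sum => s _; apply: polynomial_funM.
      exact: polynomial_fun_cst.
    apply: polynomial_fun_contraction => k i j.
    by case: (k == _); [exact: polynomial_fun_cst | exact: diag_poly].
  apply: polynomial_funM; apply: polynomial_fun_sum => s _.
    apply: polynomial_funM; first exact: polynomial_fun_cst.
    by apply: polynomial_fun_contraction => k i j.
  apply: polynomial_funM; first exact: polynomial_fun_cst.
  by apply: polynomial_fun_prod.
(* Beyond this bound the term [t u_i] dominates [w_i] for every [i]. *)
have F_large t : \sum_i `|w 0 i / u 0 i| < t -> F t = 0.
  move=> t_large; have v_pos i : 0 < v t 0 i / u 0 i.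
    rewrite !mxE mulrDl mulfK // -ltrBlDl sub0r.
    apply: le_lt_trans (ler_norm _) _; rewrite normrN; apply: le_lt_trans t_large.
    by rewrite (bigD1 i) //= lerDl sumr_ge0.
  rewrite FE ?vanish ?mulr0 // => i; apply/eqP => vi0.
  by have := v_pos i; rewrite vi0 mul0r ltxx.
have v0 : v 0 = w by rewrite /v scale0r addr0.
have w_prod : \prod_i w 0 i != 0 by apply/prodf_neq0 => i _.
have := polynomial_fun_eq0 F_poly F_large 0.
by rewrite FE v0 // => /eqP; rewrite mulf_eq0 (negbTE w_prod) => /eqP.
Qed.

Lemma inv_norms_neq0 (V : vectType R) (eps : {symmetric V}) (f : m.-tuple V) i :
  orthogonal_basis eps f -> inv_norms eps f 0 i != 0.
Proof. by case=> _ _ f_neq0; rewrite mxE invr_eq0. Qed.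

Lemma PD_vanishing_transfer (V1 V2 : vectType R) (eps1 : {symmetric V1})
    (eps2 : {symmetric V2}) (e1 f1 : m.-tuple V1) (e2 f2 : m.-tuple V2) :
  basis_of fullv e1 -> basis_of fullv e2 ->
  orthogonal_basis eps1 f1 -> orthogonal_basis eps2 f2 ->
  (forall A, alg_curvature A -> forall x y, PD e1 eps1 hl d1 d2 A x y = 0) ->
  (forall A, alg_curvature A -> forall x y, PD e2 eps2 hl d1 d2 A x y = 0).
Proof.
move=> he1 he2 hf1 hf2 vanish1 A Acurv x y; have [Alin _ _ _] := Acurv.
have [fb1 _ _] := hf1; rewrite (PD_orthogonal _ _ he2 hf2 Alin).
apply: (@diagonal_PD_continuation _ _ _ _ _ (inv_norms eps1 f1)) => [i|i|v v_pos];
  try exact: inv_norms_neq0.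
set a := coords f2 x; set b := coords f2 y; set u := inv_norms eps1 f1.
(* These factors turn the inverse norms [u] into [v]; the roots are positive
   since [v] and [u] have the same signs. *)
pose sc : 'rV[R]_m := \row_i Num.sqrt (v 0 i / u 0 i).
have sc_neq0 i : sc 0 i != 0 by rewrite mxE gt_eqF // sqrtr_gt0.
have vE : v = \row_i (sc 0 i ^+ 2 * u 0 i).
  apply/rowP => i; rewrite mxE [sc 0 i]mxE sqr_sqrtr ?ltW ?v_pos // divfK //.
  exact: inv_norms_neq0.
pose L z := \sum_i (coords f1 z 0 i * sc 0 i) *: f2`_i.
have L_linear : linear L.
  move=> c z z'; rewrite /L scaler_sumr -big_split /=; apply: eq_bigr => i _.
  by rewrite !mxE linearP /= mulrDl -mulrA scalerDl scalerA.
have LE (i : 'I_m) : L f1`_i = sc 0 i *: f2`_i.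
  rewrite /L (bigD1 i) //= big1 ?addr0 => [|j ji].
    by rewrite !mxE coord_free ?(basis_free fb1) // eqxx mul1r.
  by rewrite mxE coord_free ?(basis_free fb1) // eq_sym (negbTE ji) mul0r scale0r.
pose descale (c : 'rV[R]_m) := \sum_i (c 0 i / sc 0 i) *: f1`_i.
have descaleE c : coords f1 (descale c) = \row_i (c 0 i / sc 0 i).
  by apply/rowP => i; rewrite mxE [RHS]mxE coord_sum_free ?(basis_free fb1).
have LA_curv := alg_curvature_pullback L_linear Acurv.
have [LA_lin _ _ _] := LA_curv.
rewrite vE -(diagonal_PD_rescale _ _ _ Alin LE sc_neq0) -!descaleE.
by rewrite -(PD_orthogonal _ _ he1 hf1 LA_lin); exact: vanish1.
Qed.

End Transfer.

Theorem theorem1p7 (R : realType) (l : nat) (hl : (0 < l)%N)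
    (d1 d2 : 'S_(4 * l) -> R) (m p1 q1 p2 q2 : nat)
    (hm1 : m = (p1 + q1)%N) (hm2 : m = (p2 + q2)%N)
    (V1 : vectType R) (eps1 : {symmetric V1})
    (hV1 : inner_product_space p1 q1 eps1)
    (V2 : vectType R) (eps2 : {symmetric V2})
    (hV2 : inner_product_space p2 q2 eps2)
    (e1 : m.-tuple V1) (he1 : basis_of fullv e1)
    (e2 : m.-tuple V2) (he2 : basis_of fullv e2) :
  (forall A1 : V1 -> V1 -> V1 -> V1 -> R, alg_curvature A1 ->
     forall x y : V1, PD e1 eps1 hl d1 d2 A1 x y = 0) <->
  (forall A2 : V2 -> V2 -> V2 -> V2 -> R, alg_curvature A2 ->
     forall x y : V2, PD e2 eps2 hl d1 d2 A2 x y = 0).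
Proof.
have [f1 hf1] := inner_product_space_orthogonal_basis hm1 hV1.
have [f2 hf2] := inner_product_space_orthogonal_basis hm2 hV2.
split.
- exact: (PD_vanishing_transfer he1 he2 hf1 hf2).
- exact: (PD_vanishing_transfer he2 he1 hf2 hf1).
Qed.
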